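(* Let $P=\{p_1,\dots,p_{d-1}\}$ be a finite poset such that the Hasse diagram $\mathcal{H}(\widehat{P})$ of $\widehat{P}=P\cup\{\hat 0,\hat 1\}$ has $d+1$ vertices and $n$ edges. Fix a spanning tree $T$ of $\mathcal{H}(\widehat P)$, let $e_1,\dots,e_d$ be its edges and let $e_{d+1},\dots,e_n$ be the remaining edges of $\mathcal{H}(\widehat P)$. Define $$\mathcal{C}(P)=\Big\{(z_1,\dots,z_{n-d})\in\mathbb{R}^{n-d} : -|\mathrm{supp}^-(C)|+1\le \sum_{i=1}^{n-d}\mathbf{v}(C)^{(e_{d+i})}z_i\le |\mathrm{supp}^+(C)|-1 \ \text{ for all circuits } C \text{ of } \mathcal{H}(\widehat P)\Big\}.$$ Then the conic divisorial ideals of the Hibi ring $\Bbbk[P]$ (up to isomorphism) correspond one-to-one to the points of $\mathcal{C}(P)\cap\mathbb{Z}^{n-d}$: the map sending $z=(z_1,\dots,z_{n-d})$ to the isomorphism class of $T(\mathbf a)$, where $a_{e_j}=0$ for $1\le j\le d$ and $a_{e_{d+i}}=z_i$ for $1\le i\le n-d$, is a bijection from $\mathcal{C}(P)\cap\mathbb{Z}^{n-d}$ onto the set of isomorphism classes of conic divisorial ideals of $\Bbbk[P]$.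
   Context: $\Bbbk$ is an algebraically closed field of characteristic $0$. Toric rings and conic divisorial ideals. Let $\tau\subset\mathbb{R}^d$ be a $d$-dimensional strongly convex rational polyhedral cone with minimal system of primitive generators $v_1,\dots,v_n\in\mathbb{Z}^d$, put $\sigma_i(\mathbf x)=\langle \mathbf x,v_i\rangle$, $\sigma=(\sigma_1,\dots,\sigma_n)$, $\tau^\vee=\{\mathbf x\in\mathbb{R}^d:\sigma_i(\mathbf x)\ge 0\ \forall i\}$ and $R=\Bbbk[\tau^\vee\cap\mathbb{Z}^d]$. For $\mathbf a\in\mathbb{R}^n$, $T(\mathbf a)$ is the $R$-module generated by the Laurent monomials with exponent vector in $\{\mathbf x\in\mathbb{Z}^d:\sigma_i(\mathbf x)\ge a_i\ \forall i\}$; these are exactly the divisorial ideals of $R$. For $\mathbf a,\mathbf a'\in\mathbb{Z}^n$, $T(\mathbf a)\cong T(\mathbf a')$ iff $\mathbf a-\mathbf a'\in\sigma(\mathbb{Z}^d)$. A divisorial ideal is conic if it is (isomorphic to) $T(\lceil\sigma(\mathbf x)\rceil)$ for some $\mathbf x\in\mathbb{R}^d$ (componentwise round-up). Hibi rings. For $P=\{p_1,\dots,p_{d-1}\}$ with order $\preceq$, the Hibi ring is $\Bbbk[P]=\Bbbk[(\prod_{p_i\in I}t_i)\,t_0 : I \text{ a poset ideal (down-set) of } P]$. Put $p_0=\hat 0$, $p_d=\hat 1$ (new unique minimal and maximal elements of $\widehat P$). For each edge $e=\{p_i,p_j\}$ of the Hasse diagram $\mathcal{H}(\widehat P)$ with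 $p_i\prec p_j$, define the linear form on $\mathbb{R}^d$ (coordinates $x_0,\dots,x_{d-1}$) by $\sigma_e(\mathbf x)=x_i-x_j$ if $j\ne d$, and $\sigma_e(\mathbf x)=x_i$ if $j=d$. With $\tau_P$ the cone generated by the $\sigma_e$, one has $\Bbbk[P]=\Bbbk[\tau_P^\vee\cap\mathbb{Z}^d]$; divisorial ideals $T(\mathbf a)$ of $\Bbbk[P]$ are taken with respect to this presentation, with $\mathbf a$ indexed by the edges of $\mathcal{H}(\widehat P)$. Cycles. Regard $\mathcal{H}(\widehat P)$ as a directed graph, orienting an edge $\{p,q\}$ from $p$ to $q$ when $q$ covers $p$. For a cycle $C=(v_1,\dots,v_m)$ of $\mathcal{H}(\widehat P)$ (a cycle of the underlying undirected graph with a chosen direction of traversal, $v_{m+1}=v_1$), the signed characteristic vector $\mathbf v(C)\in\mathbb{R}^{E(\mathcal{H}(\widehat P))}$ has $e$-entry $\mathbf v(C)^{(e)}=0$ if $e\notin E(C)$, $1$ if $e=\{v_i,v_{i+1}\}$ with head $v_{i+1}$, and $-1$ if $e=\{v_i,v_{i+1}\}$ with tail $v_{i+1}$. Put $\mathrm{supp}^{\pm}(C)=\{e\in E(C):\pm\mathbf v(C)^{(e)}>0\}$. A circuit is a cycle without chords. *)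

(* Defs.v *)
From HB Require Import structures.
From mathcomp Require Import all_boot all_order all_algebra.
From mathcomp Require Import boolp classical_sets functions reals.
From mathcomp Require Import mpoly.

Set Implicit Arguments.
Unset Strict Implicit.
Unset Printing Implicit Defensive.

Import Order.TTheory GRing.Theory Num.Theory.

Local Open Scope classical_set_scope.
Local Open Scope ring_scope.

(* [low P] is P with a new minimum [None]; [hat P] is P with a new maximum
   [None] and a new minimum [Some None].  So [low P] is [hat P] minus its
   maximum: it indexes the d = #|P| + 1 coordinates x_0, ..., x_(d-1). *)
Notation low P := (option P).
Notation hat P := (option (option P)).

Section HasseDiagram.
Variables (disp : Order.disp_t) (P : finPOrderType disp).
Local Notation hat := (hat P).

Definition hat_lt (u v : hat) : bool :=
  match u, v with
  | None, _ => false
  | Some _, None => true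
  | Some None, Some (Some _) => true
  | Some _, Some None => false
  | Some (Some p), Some (Some q) => (p < q)%O
  end.

Definition covered_by (u v : hat) : bool :=
  hat_lt u v && ~~ [exists w, hat_lt u w && hat_lt w v].

End HasseDiagram.

Notation edge P := {e : hat P * hat P | covered_by e.1 e.2}.

Section Cycles.
Variables (disp : Order.disp_t) (P : finPOrderType disp).
Local Notation hat := (hat P).
Local Notation low := (low P).
Local Notation edge := (edge P).

Definition etail (e : edge) : hat := (val e).1.
Definition ehead (e : edge) : hat := (val e).2.

Definition joins (e : edge) (u v : hat) : bool :=
  ((etail e == u) && (ehead e == v)) || ((etail e == v) && (ehead e == u)).

Definition adj (A : {set edge}) : rel hat :=
  fun u v => [exists e in A, joins e u v].

(* A cycle (v_1, ..., v_m) is the sequence of its m >= 3 distinct vertices; the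
   order of the sequence is the direction of traversal. *)
Definition is_cycle (A : {set edge}) (c : seq hat) : bool :=
  ucycleb (adj A) c && (2 < size c)%N.

Definition spanning_tree (A : {set edge}) : Prop :=
  (forall u v, connect (adj A) u v) /\ (forall c, ~~ is_cycle A c).

(* [next c u] is u itself when u does not lie on c, so the edges below do have
   both ends on c. *)
Definition cycle_edges (c : seq hat) : {set edge} :=
  finset (fun e : edge =>
    (next c (etail e) == ehead e) || (next c (ehead e) == etail e)).

Definition circuit (c : seq hat) : Prop :=
  is_cycle [set: edge]%SET c /\
  forall e : edge, etail e \in c -> ehead e \in c -> e \in cycle_edges c.

Definition signed_vec (c : seq hat) (e : edge) : int :=
  if next c (etail e) == ehead e then 1
  else if next c (ehead e) == etail e then -1
  else 0.

Definition suppp (c : seq hat) : {set edge} :=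
  finset (fun e => (e \in cycle_edges c) && (0 < signed_vec c e)).
Definition suppm (c : seq hat) : {set edge} :=
  finset (fun e => (e \in cycle_edges c) && (0 < - signed_vec c e)).

(* The polytope C(P), for the enumeration [e2] of the edges outside the
   spanning tree. *)
Definition conic_region (R : realType) (m : nat) (e2 : 'I_m -> edge) :
    set 'rV[R]_m :=
  [set z | forall c, circuit c ->
     - #|suppm c|%:R + 1 <= \sum_i (signed_vec c (e2 i))%:~R * z 0 i
       <= #|suppp c|%:R - 1].

(* The linear form sigma_e, with the coordinate x_d at the maximum read as 0. *)
Definition coord (A : zmodType) (x : low -> A) (v : hat) : A :=
  if v is Some i then x i else 0.
Definition sigma (A : zmodType) (x : low -> A) (e : edge) : A :=
  coord x (etail e) - coord x (ehead e).

End Cycles.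

Local Notation tofrac := (@FracField.tofrac _).

Section Submodules.
Variable K : comNzRingType.

Definition subalgebra (k : set K) : set (set K) :=
  [set A | [/\ k `<=` A,
    forall f g, A f -> A g -> A (f + g) &
    forall f g, A f -> A g -> A (f * g)]].

Definition submodule (S : set K) : set (set K) :=
  [set M | [/\ M 0,
    forall f g, M f -> M g -> M (f + g) &
    forall r f, S r -> M f -> M (r * f)]].

(* Only the values of [phi] on M matter. *)
Definition mod_iso (S M N : set K) : Prop :=
  exists phi : K -> K, [/\ set_bij M N phi,
    forall f g, M f -> M g -> phi (f + g) = phi f + phi g &
    forall r f, S r -> M f -> phi (r * f) = r * phi f].

End Submodules.

Section HibiRing.
Variables (k : fieldType) (disp : Order.disp_t) (P : finPOrderType disp).

(* The field k(t_0, ..., t_(d-1)), in which the Laurent polynomials live. *)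
Definition ratfun : fieldType := {fraction {mpoly k[#|{: low P}|]}}.

Definition const (c : k) : ratfun := tofrac (c%:MP).
Definition var (i : low P) : ratfun := tofrac ('X_(enum_rank i)).

Definition monomial (x : low P -> int) : ratfun := \prod_i var i ^ x i.

Definition poset_ideal (I : {set P}) : Prop :=
  forall p q : P, q \in I -> (p <= q)%O -> p \in I.

Definition hibi_gen (I : {set P}) : ratfun :=
  (\prod_(p in I) var (Some p)) * var None.

Definition hibi : set ratfun :=
  smallest (subalgebra (range const)) [set hibi_gen I | I in poset_ideal].

Variable R : realType.

Definition divT (a : edge P -> R) : set ratfun :=
  smallest (submodule hibi)
    [set monomial x | x in [set x | forall e, a e <= (sigma x e)%:~R]].

Definition divisorial : set (set ratfun) := range divT.

Definition conic (M : set ratfun) : Prop :=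
  divisorial M /\
  exists x : low P -> R,
    mod_iso hibi M (divT (fun e => (Num.ceil (sigma x e))%:~R)).

Definition iso_class (M : set ratfun) : set (set ratfun) :=
  [set N | divisorial N /\ mod_iso hibi M N].

Definition conic_classes : set (set (set ratfun)) :=
  [set iso_class M | M in conic].

(* The vector a with a_(e2 i) = z_i, and a_e = 0 for e not of the form e2 i;
   for injective e2 the sum has at most one term. *)
Definition edge_vec (m : nat) (e2 : 'I_m -> edge P) (z : 'rV[int]_m)
    (e : edge P) : R :=
  \sum_(i | e2 i == e) (z 0 i)%:~R.

End HibiRing.

(* Main.v *)
(* An integral vector a is of the form ceil (sigma x) if and only if some
   real potential x satisfies a_e - 1 < sigma_e x <= a_e for every edge e.
   By the theory of shortest paths, such a potential exists unless an
   inequality fails along some cycle; since a chord splits a cycle into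
   two cycles whose inequalities add up to the one of the cycle, chordless
   cycles are enough, and this is membership in C(P). Conversely, summing
   the inequalities satisfied by a potential along a cycle gives those of
   C(P), strictly because a Hasse diagram has no directed cycle.
   Potentials on the spanning tree normalise a to 0 on the tree, in
   exactly one way. Isomorphic modules T(a) and T(b) satisfy b = a + sigma
   y for an integral y, because an isomorphism is the multiplication by a
   Laurent polynomial with Laurent inverse, and because each inequality
   sigma_e >= a_e is an equality at some exponent of T(a). *)
Require Import Defs.
From HB Require Import structures.
From mathcomp Require Import all_boot all_order all_algebra.
From mathcomp Require Import boolp classical_sets functions reals.
From mathcomp Require Import mpoly.
From mathcomp Require Import zify ring lra.

Set Implicit Arguments.
Unset Strict Implicit.
Unset Printing Implicit Defensive.

Import Order.TTheory GRing.Theory Num.Theory.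

Local Open Scope classical_set_scope.
Local Open Scope ring_scope.

(** * Weights of walks and shortest-path potentials *)

Section Weights.
Variables (V : eqType) (F : zmodType).
Implicit Types (w : V -> V -> F) (u v x y : V) (p q c : seq V).

Fixpoint path_weight w u p : F :=
  if p is v :: q then w u v + path_weight w v q else 0.

Definition cycle_weight w c : F :=
  if c is u :: p then path_weight w u (rcons p u) else 0.

Lemma path_weight_cat w u p q :
  path_weight w u (p ++ q) = path_weight w u p + path_weight w (last u p) q.
Proof. by elim: p u => [|v p IH] u /=; rewrite ?add0r // IH addrA. Qed.

Lemma cycle_weight_rot w n c : cycle_weight w (rot n c) = cycle_weight w c.
Proof.
have rot1w c' : cycle_weight w (rot 1 c') = cycle_weight w c'.
  case: c' => [|u [|v p]] //; rewrite rot1_cons /= -!cats1 !path_weight_cat /=.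
  by rewrite last_cat /= !addr0 [RHS]addrC.
elim: n => [|n IH]; first by rewrite rot0.
case: (ltnP n (size c)) => [lt|le].
  by rewrite -add1n rotD // rot1w.
by rewrite rot_oversize // ltnW.
Qed.

Lemma path_weight_nth w x0 u p :
  path_weight w u p =
  \sum_(0 <= i < size p) w (nth x0 (u :: p) i) (nth x0 p i).
Proof.
elim: p u => [|v p IH] u /=; first by rewrite big_geq.
by rewrite big_nat_recl //= IH.
Qed.

Lemma cycle_weight_next w c :
  uniq c -> cycle_weight w c = \sum_(x <- c) w x (next c x).
Proof.
case: c => [|u p] Uc; first by rewrite big_nil.
rewrite /cycle_weight (path_weight_nth _ u) size_rcons (big_nth u).
apply: eq_big_nat => i /andP[_ lti].
rewrite next_nth mem_nth // index_uniq // -rcons_cons !nth_rcons /=.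
rewrite -[(size p).+1]/(size (u :: p)) lti.
(* At the last index [nth] returns its default [u], which closes the cycle. *)
by case: ltnP => // ge; rewrite [nth u p i]nth_default // if_same.
Qed.

End Weights.

Lemma eq_path_weight (V : eqType) (F : zmodType) (e : rel V)
    (w w' : V -> V -> F) u p :
  (forall x y, e x y -> w x y = w' x y) -> path e u p ->
  path_weight w u p = path_weight w' u p.
Proof.
by move=> ww'; elim: p u => //= v p IH u /andP[euv /IH->]; rewrite ww'.
Qed.

Lemma cycle_weight_potential (V : eqType) (F : zmodType) (X : V -> F) c :
  cycle_weight (fun u v => X u - X v) c = 0.
Proof.
have pw u p : path_weight (fun u v => X u - X v) u p = X u - X (last u p).
  by elim: p u => /= [|v p IH] u; rewrite ?subrr // IH addrA subrK.
by case: c => //= u p; rewrite pw last_rcons subrr.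
Qed.

(* Shortest-path potentials: [X u] is the least weight of a simple path
   starting at [u]. *)
Lemma potential_exists (V : finType) (F : realDomainType) (r : rel V)
    (w : V -> V -> F) :
  (forall c, ucycle r c -> 0 <= cycle_weight w c) ->
  exists X : V -> F, forall u v, r u v -> X u - X v <= w u v.
Proof.
move=> wc.
(* Simple paths have length at most [#|V|], so the minimum ranges over a finite type. *)
pose T := #|V|.-bseq V.
pose simple u (p : T) := path r u p && uniq (u :: p).
pose X u := path_weight w u [arg min_(p < ([bseq] : T) | simple u p)
  path_weight w u p]%O.
have simple0 u : simple u [bseq] by [].
have XP u p : path r u p -> uniq (u :: p) -> X u <= path_weight w u p.
  move=> pp Up; have szp : (size p <= #|V|)%N.
    by apply: leq_trans (max_card (mem (u :: p))); rewrite (card_uniqP Up) /=.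
  rewrite /X; case: arg_minP => //= q _ /(_ (Bseq szp)); apply.
  by rewrite /simple /= pp.
exists X => u v ruv; rewrite lerBlDr.
rewrite [X v]/X; case: arg_minP => //= p /andP[pp Up] _.
(* If [u] is not on [v :: p], this is a simple path from [u]. Otherwise the step to [v] and the part
   of the path up to [u] close a cycle of nonnegative weight, and the rest is a simple path from
   [u]. *)
have [up|up] := boolP (u \in v :: p); last first.
  by apply: (XP u (v :: p)); rewrite /= ?ruv ?up.
case: (eqVneq u v) (up) => [uv _|neq].
  subst v; have := wc [:: u]; rewrite /ucycle /= ruv => /(_ isT).
  by rewrite addr0 => w0; apply: le_trans (XP _ _ pp Up) _; rewrite lerDr.
rewrite in_cons (negPf neq) /= => {up} up.
case/splitPr: up pp Up => p1 p2.
rewrite cat_path => /andP[pp1 /andP[lr pp2]] Up.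
rewrite -cat_rcons path_weight_cat last_rcons.
have /andP[Up2 Uvp] : uniq (u :: p2) && uniq (u :: v :: p1).
  move: Up; rewrite -cat_cons cat_uniq => /and3P[U1 /hasPn dis ->] /=.
  by move: U1; rewrite /= dis ?mem_head.
apply: le_trans (XP _ _ pp2 Up2) _; rewrite addrA lerDr.
have := wc (u :: v :: p1); rewrite /ucycle Uvp andbT; apply.
by rewrite /= ruv rcons_path pp1 lr.
Qed.

(** * Cycles of the Hasse diagram *)

Section HasseCycles.
Variables (disp : Order.disp_t) (P : finPOrderType disp).
Implicit Types (e : edge P) (u v w : hat P) (c : seq (hat P)).

Lemma hat_lt_irr u : hat_lt u u = false.
Proof. by case: u => [[p|]|] //=; rewrite ltxx. Qed.

Lemma hat_lt_trans : transitive (@hat_lt _ P).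
Proof.
by move=> [[q|]|] [[p|]|] [[r|]|] //=; apply: lt_trans.
Qed.

Lemma edge_lt e : hat_lt (etail e) (ehead e).
Proof. by have /andP[] := valP e. Qed.

Lemma val_edge_lt e u v : val e = (u, v) -> hat_lt u v.
Proof. by move=> euv; have := edge_lt e; rewrite /etail /ehead euv. Qed.

Lemma edge_neq e : etail e != ehead e.
Proof. by apply/eqP => eq; have := edge_lt e; rewrite eq hat_lt_irr. Qed.

Lemma edge_cover e w :
  hat_lt (etail e) w -> hat_lt w (ehead e) -> False.
Proof.
move=> uw wv; have /andP[_ /existsPn/(_ w)] := valP e.
by rewrite uw wv.
Qed.

Lemma val_edgeE e u v : (val e == (u, v)) = (etail e == u) && (ehead e == v).
Proof. by rewrite /etail /ehead; case: (val e). Qed.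

Lemma edge_inj e e' : etail e = etail e' -> ehead e = ehead e' -> e = e'.
Proof.
move=> t h; apply: val_inj; rewrite [LHS]surjective_pairing.
by rewrite [RHS]surjective_pairing; congr pair.
Qed.

Lemma joinsP e u v :
  reflect (val e = (u, v) \/ val e = (v, u)) (joins e u v).
Proof.
rewrite /joins /etail /ehead; case: (val e) => a b /=; rewrite -!xpair_eqE.
by apply: (iffP orP) => -[/eqP|/eqP]; auto.
Qed.

Section EdgeWeight.
Variables (F : zmodType) (f g : edge P -> F).

(** An edge weighs [f] upwards and [g] downwards. Each sum has at most one term, and pairs that no
    edge joins get the weight 0. *)
Definition edge_weight u v : F :=
  \sum_(e | val e == (u, v)) f e + \sum_(e | val e == (v, u)) g e.

Lemma edge_weight_fw e : edge_weight (etail e) (ehead e) = f e.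
Proof.
rewrite /edge_weight (big_pred1 e) => [|e']; last first.
  by rewrite -surjective_pairing.
rewrite big_pred0 ?addr0 // => e'; apply/negP => /eqP ee'.
by have := hat_lt_trans (edge_lt e) (val_edge_lt ee'); rewrite hat_lt_irr.
Qed.

Lemma edge_weight_bw e : edge_weight (ehead e) (etail e) = g e.
Proof.
rewrite /edge_weight addrC (big_pred1 e) => [|e']; last first.
  by rewrite -surjective_pairing.
rewrite big_pred0 ?addr0 // => e'; apply/negP => /eqP ee'.
by have := hat_lt_trans (edge_lt e) (val_edge_lt ee'); rewrite hat_lt_irr.
Qed.

End EdgeWeight.

(** Once the cycle is rotated to start at [u], the successor of [v] is a third vertex. Hence no edge
    is traversed in both directions, and the two supports are disjoint. *)
Lemma next_next_neq c u v :
  uniq c -> (2 < size c)%N -> next c u = v -> next c v = u -> u = v.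
Proof.
move=> Uc sz uv vu; have [cu|cu] := boolP (u \in c); last first.
  by rewrite -uv next_nth (negPf cu).
have [i q qe] := rot_to cu.
have Uq : uniq (u :: q) by rewrite -qe rot_uniq.
move: sz uv vu; rewrite -(size_rot i) -(next_rot i Uc u) -(next_rot i Uc v) qe.
case: q Uq {qe} => [|y [|z q]] //= /and3P[u_ y_ _] _; rewrite eqxx => <- .
rewrite eqxx; case: eqVneq => // _ zu; move: u_.
by rewrite zu !inE eqxx orbT.
Qed.

Lemma suppp_next c e : (e \in suppp c) = (next c (etail e) == ehead e).
Proof.
rewrite !inE /signed_vec; case: eqP => //= _.
by case: ifP => _; rewrite ?andbF.
Qed.

Lemma suppm_next c e : uniq c -> (2 < size c)%N ->
  (e \in suppm c) = (next c (ehead e) == etail e).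
Proof.
move=> Uc sz; rewrite !inE /signed_vec.
case: eqP => /= [th|_]; last by case: eqP.
case: eqP => // ht; have := edge_neq e.
by rewrite (next_next_neq Uc sz th ht) eqxx.
Qed.

Lemma sum_signed_vec (F : pzRingType) (a : edge P -> F) c :
  uniq c -> (2 < size c)%N ->
  \sum_e (signed_vec c e)%:~R * a e =
  \sum_(e in suppp c) a e - \sum_(e in suppm c) a e.
Proof.
move=> Uc sz; rewrite [X in X - _]big_mkcond [X in _ - X]big_mkcond -sumrB.
apply: eq_bigr => e _; rewrite suppp_next suppm_next // /signed_vec.
case: eqP => [th|_].
  case: eqP => ht; last by rewrite mul1r subr0.
  by have := edge_neq e; rewrite (next_next_neq Uc sz th ht) eqxx.
by case: eqP => _; rewrite sub0r ?mulrNz ?mulN1r // mul0r oppr0.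
Qed.

Lemma cycle_weight_edges (F : zmodType) (f g : edge P -> F) c :
  uniq c -> (2 < size c)%N ->
  cycle_weight (edge_weight f g) c =
  \sum_(e in suppp c) f e + \sum_(e in suppm c) g e.
Proof.
move=> Uc sz; rewrite cycle_weight_next // big_split /=.
(* Here [m e] is the vertex where the traversal of [e] starts: its tail on the positive support, its
   head on the negative one. Each edge of [s] is thus counted exactly once. *)
have swap (h : edge P -> F) (b : edge P -> hat P -> bool) (s : {set edge P})
    (m : edge P -> hat P) :
    (forall e u, u \in c -> b e u = (u == m e) && (e \in s)) ->
    (forall e, e \in s -> m e \in c) ->
    \sum_(u <- c) \sum_(e | b e u) h e = \sum_(e in s) h e.
  move=> bE ms; rewrite (exchange_big_dep xpredT) //= [RHS]big_mkcond.
  apply: eq_bigr => e _; rewrite big_seq_cond.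
  case: ifP => es; last first.
    by rewrite big1 // => u /andP[uc]; rewrite bE // es andbF.
  rewrite -big_filter.
  rewrite (perm_big [:: m e]) ?big_seq1 //.
  apply: uniq_perm => //; first exact: filter_uniq.
  move=> u; rewrite mem_filter inE; case: (boolP (u \in c)) => /= uc.
    by rewrite bE // es !andbT.
  by apply/esym/negP => /eqP ue; rewrite ue ms in uc.
have in_c u v : u != v -> next c u == v -> u \in c.
  by move=> uv; rewrite next_nth; case: ifP => // _; rewrite (negPf uv).
congr (_ + _).
  apply: (swap _ _ _ (@etail _ P)) => [e u _|e]; rewrite suppp_next.
    by rewrite val_edgeE eq_sym; case: eqVneq => //= ->; rewrite eq_sym.
  exact: in_c (edge_neq e).
apply: (swap _ _ _ (@ehead _ P)) => [e u _|e]; rewrite suppm_next //.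
  rewrite val_edgeE andbC eq_sym; case: eqVneq => //= ->.
  by rewrite eq_sym.
by apply: in_c; rewrite eq_sym edge_neq.
Qed.

Lemma adjT u v e : joins e u v -> adj [set: edge P]%SET u v.
Proof. by move=> j; apply/existsP; exists e; rewrite inE. Qed.

Lemma adjP (A : {set edge P}) u v :
  reflect (exists2 e, e \in A & joins e u v) (adj A u v).
Proof. by apply: (iffP exists_inP). Qed.

(** By transitivity such a cycle would relate each of its vertices to itself. *)
Lemma cycle_hat_lt c : (0 < size c)%N -> ~~ cycle (@hat_lt _ P) c.
Proof.
case: c => // u c _; rewrite (cycle_all2rel hat_lt_trans).
apply/negP => /allrelP/(_ u u (mem_head _ _) (mem_head _ _)).
by rewrite hat_lt_irr.
Qed.

Lemma cycle_hat_gt c : (0 < size c)%N ->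
  ~~ cycle (fun u v => @hat_lt _ P v u) c.
Proof.
have tr : transitive (fun u v => @hat_lt _ P v u).
  by move=> v u w vu wv; apply: hat_lt_trans wv vu.
case: c => // u c _; rewrite (cycle_all2rel tr).
apply/negP => /allrelP/(_ u u (mem_head _ _) (mem_head _ _)).
by rewrite hat_lt_irr.
Qed.

(* A Hasse diagram has no directed cycle. *)
Lemma suppm_gt0 c : is_cycle [set: edge P]%SET c -> (0 < #|suppm c|)%N.
Proof.
case/andP=> /andP[cyc Uc] sz; rewrite lt0n; apply/negP => /eqP/cards0_eq s0.
have /negP := @cycle_hat_lt c (ltn_trans (isT : 0 < 2)%N sz); apply.
apply: cycle_from_next => // u uc.
have /adjP[e _ /joinsP[]] := next_cycle cyc uc.
  exact: val_edge_lt.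
move=> ee; have : e \in suppm c; last by rewrite s0 inE.
by rewrite suppm_next // /etail /ehead ee.
Qed.

Lemma suppp_gt0 c : is_cycle [set: edge P]%SET c -> (0 < #|suppp c|)%N.
Proof.
case/andP=> /andP[cyc Uc] sz; rewrite lt0n; apply/negP => /eqP/cards0_eq s0.
have /negP := @cycle_hat_gt c (ltn_trans (isT : 0 < 2)%N sz); apply.
apply: cycle_from_next => // u uc.
have /adjP[e _ /joinsP[]] := next_cycle cyc uc; last first.
  exact: val_edge_lt.
move=> ee; have : e \in suppp c; last by rewrite s0 inE.
by rewrite suppp_next // /etail /ehead ee.
Qed.

(* A chord splits a cycle into two shorter ones, and is traversed once in each
   direction; the two traversals together weigh [1]. *)
Lemma cycle_weight_circuits (F : realDomainType) (f : edge P -> F) :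
  let w := edge_weight f (fun e => 1 - f e) in
  (forall c, circuit c -> 1 <= cycle_weight w c) ->
  forall c, is_cycle [set: edge P]%SET c -> 1 <= cycle_weight w c.
Proof.
move=> w wc c; have [n] := ubnP (size c); elim: n c => // n IH c szn cyc.
have [circ|] := pselect (circuit c); first exact: wc.
move=> ncirc; have [e [tc hc ec]] : exists e,
    [/\ etail e \in c, ehead e \in c & e \notin cycle_edges c].
  apply: contra_notP ncirc => /forallNP ne; split=> // e tc hc.
  by apply: contraT => ec; case: (ne e).
move: ec; rewrite inE negb_or => /andP[th ht].
have /andP[/andP[cc Uc] sz] := cyc.
(* Up to rotation the cycle reads [u :: p ++ v :: q], where [u] and [v] are the ends of the
   chord. *)
have [i p q _ _ rot_c] := rot_to_arc Uc tc hc (edge_neq e).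
move: th ht; rewrite -(next_rot i Uc (etail e)) -(next_rot i Uc (ehead e)).
rewrite -(cycle_weight_rot _ i).
move: cc sz szn Uc; rewrite -(rot_cycle i) -(size_rot i) -(rot_uniq i).
rewrite {}rot_c {i c cyc ncirc tc hc}.
set u := etail e; set v := ehead e => cc sz szn Uc th ht.
(* Both arcs have inner vertices, since the chord is not an edge of the cycle; so both halves have
   at least three vertices and are shorter than the cycle. *)
have p0 : (0 < size p)%N by case: p th {Uc cc sz szn ht} => //=; rewrite !eqxx.
have q0 : (0 < size q)%N.
  case: q ht {cc sz szn th} Uc => // + Uc.
  by rewrite -(next_rot (size (u :: p)) Uc) -cat_cons rot_size_cat /= !eqxx.
have [euv evu] : adj [set: edge P]%SET u v /\ adj [set: edge P]%SET v u.
  by split; apply: (adjT (e := e)); rewrite /joins !eqxx ?orbT.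
have cuv : w u v + w v u = 1.
  by rewrite /w edge_weight_fw edge_weight_bw addrC subrK.
have : path (adj [set: edge P]%SET) u (p ++ v :: rcons q u).
  by move: cc; rewrite /= rcons_cat.
rewrite cat_path => /andP[pp /andP[lv pq]].
have /andP[Up Uq] : uniq (u :: rcons p v) && uniq (v :: rcons q u).
  have Uc' := Uc.
  rewrite -(rot_uniq (size (u :: p))) -cat_cons rot_size_cat in Uc'.
  move: Uc Uc'; rewrite -cat_cons -!cat_rcons !cat_uniq.
  by move=> /and3P[-> _ _] /and3P[-> _ _].
have C1 : 1 <= cycle_weight w (u :: rcons p v).
  apply: IH.
    by move: szn q0; rewrite /= size_rcons size_cat /=; clear; lia.
  rewrite /is_cycle /ucycleb Up /= size_rcons !ltnS p0 andbT.
  by rewrite !rcons_path pp last_rcons /= lv evu.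
have C2 : 1 <= cycle_weight w (v :: rcons q u).
  apply: IH.
    by move: szn p0; rewrite /= size_rcons size_cat /=; clear; lia.
  rewrite /is_cycle /ucycleb Uq /= size_rcons !ltnS q0 andbT.
  by rewrite rcons_path last_rcons euv !andbT.
have : cycle_weight w (u :: rcons p v) + cycle_weight w (v :: rcons q u)
   = cycle_weight w (u :: p ++ v :: q) + 1.
  rewrite -cuv /= -!cats1 -!catA !path_weight_cat /=.
  ring.
by move=> cw; rewrite -(lerD2r 1) -cw lerD.
Qed.

End HasseCycles.

(** * Potentials with prescribed bounds on the edges *)

Section Potentials.
Variables (disp : Order.disp_t) (P : finPOrderType disp).
Implicit Types (e : edge P) (u v : hat P) (c : seq (hat P)).

Lemma sigma_hat (F : zmodType) (h : hat P -> F) e :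
  h None = 0 -> sigma (fun i => h (Some i)) e = h (etail e) - h (ehead e).
Proof.
move=> h0; rewrite /sigma.
by case: etail => [i|]; case: ehead => [j|] /=; rewrite ?h0.
Qed.

Lemma sigmaD (F : zmodType) (x y : low P -> F) e :
  sigma (fun i => x i + y i) e = sigma x e + sigma y e.
Proof.
rewrite /sigma; case: etail => [i|]; case: ehead => [j|] /=.
- by rewrite opprD addrACA.
- by rewrite !subr0.
- by rewrite !sub0r opprD.
- by rewrite !subr0 addr0.
Qed.

Lemma sigmaN (F : zmodType) (x : low P -> F) e :
  sigma (fun i => - x i) e = - sigma x e.
Proof.
by rewrite /sigma opprB addrC; case: etail => [i|]; case: ehead => [j|] /=;
  rewrite ?opprK ?oppr0.
Qed.

Lemma sigma_intr (R : pzRingType) (x : low P -> int) e :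
  sigma (fun i => (x i)%:~R : R) e = (sigma x e)%:~R.
Proof.
by rewrite /sigma rmorphB; case: etail => [i|]; case: ehead => [j|] //=.
Qed.

(** Both bounds become shortest-path inequalities, one for each direction of an edge. The hypothesis
    on [f e + g e] handles going back and forth along an edge, which [is_cycle] excludes. *)
Lemma edge_potential (F : realDomainType) (A : {set edge P})
    (f g : edge P -> F) :
  (forall e, 0 <= f e + g e) ->
  (forall c, is_cycle A c -> 0 <= cycle_weight (edge_weight f g) c) ->
  exists x : low P -> F, forall e, e \in A -> - g e <= sigma x e <= f e.
Proof.
move=> fg wc.
have [|X XP] := @potential_exists _ _ (adj A) (edge_weight f g).
  move=> c /andP[cyc Uc]; have [sz|] := ltnP 2 (size c).
    by apply: wc; rewrite /is_cycle /ucycleb cyc Uc.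
  case: c cyc Uc => [|u [|v []]] //= cyc.
    move: cyc; rewrite andbT => /adjP[e _ /joinsP ee] _ _.
    have := edge_neq e; rewrite /etail /ehead.
    by case: ee => -> /=; rewrite eqxx.
  case/and3P: cyc => /adjP[e _ /joinsP ee] _ _ _ _; rewrite addr0.
  have := fg e; rewrite -(edge_weight_fw f g e) -(edge_weight_bw f g e).
  by rewrite /etail /ehead; case: ee => -> //=; rewrite addrC.
(* The potential is shifted to vanish at the maximum, as [coord] requires. *)
exists (fun i => X (Some i) - X None) => e eA.
rewrite (@sigma_hat _ (fun u => X u - X None)) ?subrr //.
have X1 : X (etail e) - X (ehead e) <= f e.
  rewrite -(edge_weight_fw f g e); apply/XP/adjP; exists e => //.
  by rewrite /joins !eqxx.
have X2 : X (ehead e) - X (etail e) <= g e.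
  rewrite -(edge_weight_bw f g e); apply/XP/adjP; exists e => //.
  by rewrite /joins !eqxx orbT.
by rewrite opprB addrA subrK X1 lerNl opprB X2.
Qed.

(** Without cycles the cycle condition is empty, so the two bounds may coincide; this also works
    over the integers. *)
Lemma forest_potential (F : realDomainType) (A : {set edge P})
    (a : edge P -> F) :
  (forall c, ~~ is_cycle A c) ->
  exists x : low P -> F, forall e, e \in A -> sigma x e = a e.
Proof.
move=> forest; have [e||x xP] := @edge_potential F A a (fun e => - a e).
- by rewrite subrr.
- by move=> c cyc; have := forest c; rewrite cyc.
by exists x => e /xP; rewrite opprK -eq_le => /eqP.
Qed.

(** The coordinate is 0 at the maximum, and this value propagates along the paths of [A]. *)
Lemma connected_potential0 (F : zmodType) (A : {set edge P}) (x : low P -> F) :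
  (forall u v, connect (adj A) u v) ->
  (forall e, e \in A -> sigma x e = 0) -> forall e, sigma x e = 0.
Proof.
move=> conn x0; suff c0 v : Defs.coord x v = 0.
  by move=> e; rewrite /sigma !c0 subrr.
have /connectP[p pp ->] := conn None v.
elim/last_ind: p pp => //= p u IH; rewrite rcons_path last_rcons.
case/andP=> /IH c0 /adjP[e eA /joinsP].
have := x0 e eA; rewrite /sigma /etail /ehead => + [] ee; rewrite ee /= c0.
  by rewrite sub0r => /eqP; rewrite oppr_eq0 => /eqP.
by rewrite subr0.
Qed.

(** The strict bound is replaced by a weak one with slack [d]. Lowering the downward weights by [d]
    costs a cycle at most [N * d < 1], so its weight stays nonnegative. *)
Lemma ceil_potential (F : realFieldType) (a : edge P -> F) :
  (forall c, is_cycle [set: edge P]%SET c ->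
     1 <= cycle_weight (edge_weight a (fun e => 1 - a e)) c) ->
  exists x : low P -> F, forall e, a e - 1 < sigma x e <= a e.
Proof.
move=> ca; set N : F := #|{: edge P}|%:R.
have N0 : 0 <= N by rewrite ler0n.
pose d := (N + 1)^-1; have d0 : 0 < d by rewrite invr_gt0; lra.
have Nd : (N + 1) * d = 1 by rewrite mulfV //; lra.
have [e|c cyc|x xP] :=
  @edge_potential F [set: edge P]%SET a (fun e => 1 - d - a e).
- by have := mulr_ge0 N0 (ltW d0); lra.
- have /andP[/andP[_ Uc] sz] := cyc; have := ca c cyc.
  rewrite !cycle_weight_edges // !big_split /= !sumrN !sumr_const.
  have mN : #|suppm c|%:R <= N by rewrite ler_nat max_card.
  have md : #|suppm c|%:R * d <= N * d by rewrite ler_wpM2r // ltW.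
  rewrite -[d *+ _]mulr_natl; lra.
by exists x => e; have := xP e (finset.in_setT e); clear -d0; lra.
Qed.

(** A function [H] that is constant along [e0] and drops by at least 1 along every other edge, taken
    with a large factor, satisfies all other inequalities; a correction at the tail of [e0] then
    gives the equality. *)
Lemma sigma_tight (a : edge P -> int) e0 :
  exists2 x : low P -> int, sigma x e0 = a e0 & forall e, a e <= sigma x e.
Proof.
pose le u v := (u == v) || hat_lt u v.
have le_lt u v w : le u v -> hat_lt v w -> hat_lt u w.
  by case/orP=> [/eqP->//|]; apply: hat_lt_trans.
have le_tr u v w : le v w -> le u v -> le u w.
  by case/orP=> [/eqP->//|vw] /le_lt/(_ vw); rewrite /le orbC => ->.
pose t := etail e0; pose h := ehead e0.
have th : le t h by rewrite /le edge_lt orbT.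
(* For every edge [e] other than [e0], an up-set that contains the head of [e]
   but not its tail, and contains both ends of [e0] or none. *)
pose U e v := le (ehead e) v || (le (ehead e) h && le t v).
have Uup e v w : le v w -> U e v -> U e w.
  by move=> vw /orP[/(le_tr _ _ _ vw)|/andP[eh /(le_tr _ _ _ vw)]];
    rewrite /U => -> //; rewrite eh orbT.
have Uth e : U e t = U e h.
  apply/idP/idP; first exact: Uup.
  by rewrite /U /le eqxx /= andbT => /orP[->|/andP[->]]; rewrite orbT.
have Uh e : U e (ehead e) by rewrite /U /le eqxx.
(* Otherwise [e] would lie between [t] and [h]; as [h] covers [t], this forces [e = e0]. *)
have Ut e : e != e0 -> ~~ U e (etail e).
  move=> ne; apply/negP => /orP[/le_lt/(_ (edge_lt e))|/andP[eh te]].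
    by rewrite hat_lt_irr.
  case/orP: te => [/eqP te|te]; last first.
    case/orP: eh => [/eqP eh|eh].
      apply: (edge_cover te); rewrite -/h -eh; exact: edge_lt.
    by apply: (edge_cover te); apply: hat_lt_trans (edge_lt e) eh.
  case/orP: eh => [/eqP eh|eh]; first by case/eqP: ne; apply: edge_inj.
  by apply: (edge_cover _ eh); rewrite -/t te edge_lt.
pose H v : int := \sum_(e | e != e0) (~~ U e v : nat)%:Z.
have Hd e v w : le v w -> (~~ U e w : nat)%:Z <= (~~ U e v : nat)%:Z :> int.
  by move/(Uup e); case: (U e v) => [->|] //; case: (U e w).
have H0 : H None = 0.
  apply: big1 => e _; rewrite /U; suff -> : le (ehead e) None by [].
  by rewrite /le; case: (ehead e) => [[z|]|].
have He0 : H t = H h by apply: eq_bigr => e _; rewrite Uth.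
have He e : e != e0 -> 1 <= H (etail e) - H (ehead e).
  move=> ne; rewrite /H -sumrB (bigD1 e) //= Ut // Uh subr0 lerDl.
  apply: sumr_ge0 => e' _; rewrite subr_ge0; apply: Hd.
  by rewrite /le edge_lt orbT.
pose K : int := \sum_e `|a e|.
have aK e : `|a e| <= K by rewrite /K (bigD1 e) //= lerDl sumr_ge0.
(* One [K] dominates [a e], the other absorbs the correction at [t]. *)
pose X v : int := (K + K) * H v + a e0 * (v == t : nat)%:Z.
have X0 : X None = 0.
  rewrite /X H0 mulr0 add0r; case: eqP => [t0|_]; last by rewrite mulr0.
  by have := edge_lt e0; rewrite -/t -t0.
have sX e : sigma (fun i => X (Some i)) e =
    (K + K) * (H (etail e) - H (ehead e))
    + a e0 * ((etail e == t : nat)%:Z - (ehead e == t : nat)%:Z).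
  by rewrite sigma_hat // /X; ring.
have s0 : sigma (fun i => X (Some i)) e0 = a e0.
  rewrite sX -/t -/h He0 subrr mulr0 add0r eqxx eq_sym (negPf (edge_neq e0)).
  by rewrite subr0 mulr1.
exists (fun i => X (Some i)) => // e.
have [->|ne] := eqVneq e e0; first by rewrite s0.
rewrite sX; have K0 : 0 <= K by apply: le_trans (aK e).
have h1 : (K + K) * 1 <= (K + K) * (H (etail e) - H (ehead e)).
  by rewrite ler_wpM2l ?He // addr_ge0.
have h2 : - `|a e0| <=
    a e0 * ((etail e == t : nat)%:Z - (ehead e == t : nat)%:Z).
  by case: (etail e == t); case: (ehead e == t) => /=; lia.
have := aK e; have := aK e0; move: h1 h2.
move: (_ * (_ - _)) (a e0 * _) (`|a e0|) => A B C.
by have := ler_norm (a e); lia.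
Qed.

End Potentials.

(** * Laurent polynomials and their exponents *)

Local Notation tofrac := (@FracField.tofrac _).

Section Laurent.
Variables (k : fieldType) (disp : Order.disp_t) (P : finPOrderType disp).
Local Notation K := (ratfun k P).
Local Notation n := #|{: low P}|.
Implicit Types (f g : K) (x y : low P -> int).

Lemma tofracX_neq0 (m : 'X_{1..n}) : tofrac 'X_[m] != 0 :> K.
Proof.
rewrite tofrac_eq0; apply/eqP => /(congr1 (mcoeff m))/eqP.
by rewrite mcoeffX mcoeff0 eqxx oner_eq0.
Qed.

Lemma var_neq0 i : var k i != 0 :> K.
Proof. exact: tofracX_neq0. Qed.

Lemma monomialD x y :
  monomial k (fun i => x i + y i) = monomial k x * monomial k y.
Proof.
by rewrite -big_split; apply: eq_bigr => i _; rewrite expfzDr ?var_neq0.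
Qed.

Lemma monomial0 : monomial k (fun _ => 0) = 1 :> K.
Proof. by apply: big1 => i _; rewrite expr0z. Qed.

Lemma monomial_neq0 x : monomial k x != 0 :> K.
Proof. by apply/prodf_neq0 => i _; rewrite expfz_neq0 ?var_neq0. Qed.

Lemma monomialN x : monomial k (fun i => - x i) = (monomial k x)^-1 :> K.
Proof.
apply: (mulfI (monomial_neq0 x)); rewrite mulfV ?monomial_neq0 // -monomialD.
by rewrite -monomial0; apply: eq_bigr => i _; rewrite subrr.
Qed.

Definition mdiag (N : nat) : 'X_{1..n} := [multinom N | _ < n].

(** The product of all variables, whose powers serve as common denominators. *)
Definition vars : K := tofrac 'X_[mdiag 1].

Lemma varsX N : vars ^+ N = tofrac 'X_[mdiag N].
Proof.
rewrite -tofracXn mpolyXn; congr (tofrac 'X_[_]).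
by apply/mnmP => i; rewrite mulmnE !mnmE mul1n.
Qed.

Lemma monomial_nat (m : 'X_{1..n}) :
  monomial k (fun i => (m (enum_rank i))%:Z) = tofrac 'X_[m] :> K.
Proof.
rewrite mpolyXE_id rmorph_prod /= (reindex (@enum_rank (low P))) /=; last first.
  by exists enum_val => i _; rewrite ?enum_rankK ?enum_valK.
by apply: eq_bigr => i _; rewrite rmorphXn /= -exprnP.
Qed.

(* [f] is a Laurent polynomial whose exponents are all [>= - N]. *)
Definition laurent_at f N p := f * vars ^+ N = tofrac p.

Definition laurent f := exists N p, laurent_at f N p.

Definition has_term f x := exists N p (m : 'X_{1..n}),
  [/\ laurent_at f N p, forall i, x i + N%:Z = (m (enum_rank i))%:Z
    & p@_m != 0].

Lemma laurent_atD f N p M : laurent_at f N p ->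
  laurent_at f (N + M) (p * 'X_[mdiag M]).
Proof. by rewrite /laurent_at exprD mulrA => ->; rewrite varsX tofracM. Qed.

Lemma laurent_at_inj f N p q : laurent_at f N p -> laurent_at f N q -> p = q.
Proof. by rewrite /laurent_at => -> /eqP; rewrite tofrac_eq => /eqP. Qed.

Lemma mnm_shift x N M (m m' : 'X_{1..n}) :
  (forall i, x i + N%:Z = (m (enum_rank i))%:Z) ->
  (forall i, x i + M%:Z = (m' (enum_rank i))%:Z) ->
  (m + mdiag M = m' + mdiag N)%MM.
Proof.
move=> xm xm'; apply/mnmP => i; rewrite !mnmDE !mnmE.
have := xm (enum_val i); have := xm' (enum_val i); rewrite enum_valK.
by clear; lia.
Qed.

(** Over a common denominator two representations of [f] have the same numerator, since [tofrac] is
    injective; so [has_term] does not depend on the representation. *)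
Lemma has_term_exponent f x N p : laurent_at f N p -> has_term f x ->
  exists2 m : 'X_{1..n}, p@_m != 0 &
    forall i, x i + N%:Z = (m (enum_rank i))%:Z.
Proof.
move=> fp [M [q [m' [fq xm' q0]]]].
have fpM := laurent_atD M fp; have fqN := laurent_atD N fq.
rewrite addnC in fqN; have pq := laurent_at_inj fpM fqN.
have : (p * 'X_[mdiag M])@_(mdiag N + m') != 0 by rewrite pq mcoeffMX.
rewrite -mcoeff_msupp => /msuppM_le/allpairsP[[m1 m2] /= [m1p]].
rewrite msuppX inE => /eqP -> mm; exists m1.
  by rewrite mcoeff_msupp in m1p.
move=> i; have := xm' i; have /mnmP/(_ (enum_rank i)) := mm.
rewrite !mnmDE !mnmE; clear; lia.
Qed.

Lemma laurentM f g : laurent f -> laurent g -> laurent (f * g).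
Proof.
move=> [N [p fp]] [M [q gq]]; exists (N + M)%N, (p * q).
by rewrite /laurent_at exprD mulrACA fp gq tofracM.
Qed.

Lemma laurentD f g : laurent f -> laurent g -> laurent (f + g).
Proof.
move=> [N [p fp]] [M [q gq]].
exists (N + M)%N, (p * 'X_[mdiag M] + q * 'X_[mdiag N]).
rewrite /laurent_at mulrDl (laurent_atD M fp) addnC (laurent_atD N gq).
by rewrite tofracD.
Qed.

Lemma laurent_tofrac p : laurent_at (tofrac p) 0 p.
Proof. by rewrite /laurent_at expr0 mulr1. Qed.

Lemma has_termM f g z : laurent f -> laurent g -> has_term (f * g) z ->
  exists x y, [/\ has_term f x, has_term g y & forall i, z i = x i + y i].
Proof.
move=> [N [p fp]] [M [q gq]] fgz.
have fgpq : laurent_at (f * g) (N + M) (p * q).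
  by rewrite /laurent_at exprD mulrACA fp gq tofracM.
have [m pqm zm] := has_term_exponent fgpq fgz.
move: pqm; rewrite -mcoeff_msupp => /msuppM_le/allpairsP[[m1 m2] /=].
rewrite !mcoeff_msupp => -[p1 q2 mm].
exists (fun i => (m1 (enum_rank i))%:Z - N%:Z).
exists (fun i => (m2 (enum_rank i))%:Z - M%:Z); split.
- by exists N, p, m1; split=> // i; rewrite subrK.
- by exists M, q, m2; split=> // i; rewrite subrK.
by move=> i; have := zm i; rewrite mm mnmDE; clear; lia.
Qed.

Lemma has_termD f g z : laurent f -> laurent g -> has_term (f + g) z ->
  has_term f z \/ has_term g z.
Proof.
move=> [N [p fp]] [M [q gq]] fgz.
have fN := laurent_atD M fp; have gN := laurent_atD N gq; rewrite addnC in gN.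
have fgN : laurent_at (f + g) (N + M) (p * 'X_[mdiag M] + q * 'X_[mdiag N]).
  by rewrite /laurent_at mulrDl fN gN tofracD.
have [m pqm zm] := has_term_exponent fgN fgz.
have [p0|p0] := eqVneq (p * 'X_[mdiag M])@_m 0; last first.
  by left; exists (N + M)%N, (p * 'X_[mdiag M]), m.
right; exists (N + M)%N, (q * 'X_[mdiag N]), m; split=> //.
by move: pqm; rewrite mcoeffD p0 add0r.
Qed.

Lemma laurent_monomial_at x : exists N (m : 'X_{1..n}),
  laurent_at (monomial k x) N 'X_[m] /\
  forall i, x i + N%:Z = (m (enum_rank i))%:Z.
Proof.
(* This [N] dominates every [- x i], so the shifted exponents are natural numbers. *)
pose N : nat := \sum_i `|x i|%N.
pose m : 'X_{1..n} := [multinom `|(x (enum_val i) + N%:Z)%R|%N | i < n].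
have xm i : x i + N%:Z = (m (enum_rank i))%:Z.
  rewrite mnmE enum_rankK.
  have : (`|x i| <= N)%N by rewrite /N (bigD1 i) //= leq_addr.
  by clear; lia.
exists N, m; split=> //; rewrite /laurent_at -monomial_nat varsX -monomial_nat.
rewrite -monomialD; apply: eq_bigr => i _.
by rewrite -xm mnmE.
Qed.

Lemma laurent_monomial x : laurent (monomial k x).
Proof. by have [N [m [xN _]]] := laurent_monomial_at x; exists N, 'X_[m]. Qed.

Lemma has_term_monomial x y : has_term (monomial k x) y <-> x =1 y.
Proof.
have [N [m [xN xm]]] := laurent_monomial_at x; split=> [|xy].
  case/(has_term_exponent xN) => m'; rewrite mcoeffX.
  case: (m =P m') => [<- _ ym i|_]; last by rewrite eqxx.
  by apply: (addIr N%:Z); rewrite xm.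
exists N, 'X_[m], m; split=> // [i|]; first by rewrite -xy.
by rewrite mcoeffX eqxx oner_eq0.
Qed.

Lemma laurent0 : laurent 0.
Proof. by exists 0, 0; rewrite /laurent_at mul0r tofrac0. Qed.

Lemma has_term0 x : ~ has_term 0 x.
Proof.
have z : laurent_at 0 0 0 by rewrite /laurent_at mul0r tofrac0.
by case/(has_term_exponent z) => m; rewrite mcoeff0 eqxx.
Qed.

(** A monomial is invertible: [has_termM], applied to [f] written as the inverse monomial times the
    product, finds the term of the product. *)
Lemma has_term_translate f x y : laurent f -> has_term f x ->
  has_term (monomial k y * f) (fun i => y i + x i).
Proof.
move=> lf fx; have yK : f = monomial k (fun i => - y i) * (monomial k y * f).
  by rewrite monomialN mulKf // monomial_neq0.
move: fx; rewrite {1}yK => /has_termM[||u [v [/has_term_monomial yu fv xuv]]].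
- exact: laurent_monomial.
- by apply: laurentM => //; apply: laurent_monomial.
have -> // : (fun i => y i + x i) = v.
by apply/funext => i; rewrite xuv -yu addNKr.
Qed.

End Laurent.

(** * Fractions, generated submodules and their isomorphisms *)

Section FractionField.
Variable A : idomainType.

Lemma fractionP (f : {fraction A}) :
  exists p q : A, q != 0 /\ f = tofrac p / tofrac q.
Proof.
elim/quotW: f => x; exists (frac x).1, (frac x).2; have d0 := denom_ratioP x.
split=> //; apply: (mulIf (_ : tofrac (frac x).2 != 0)).
  by rewrite tofrac_eq0.
rewrite mulfVK ?tofrac_eq0 //; unlock FracField.tofrac.
rewrite -[LHS]FracField.pi_mul; apply/eqmodP; rewrite /= FracField.equivfE.
by rewrite /FracField.mulf !numden_Ratio ?mulr1 ?oner_eq0 // mulrC.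
Qed.

End FractionField.

Section SmallestSubmodule.
Variables (K : comNzRingType) (S : set K).

Lemma subalgebra_smallest (B G : set K) :
  subalgebra B (smallest (subalgebra B) G).
Proof.
split=> [f Bf A [[BA _ _] _]|f g fS gS A AP|f g fS gS A AP]; first exact: BA.
- by have [[_ AD _] _] := AP; apply: AD; [apply: fS|apply: gS].
by have [[_ _ AM] _] := AP; apply: AM; [apply: fS|apply: gS].
Qed.

Lemma submodule_smallest (G : set K) : submodule S (smallest (submodule S) G).
Proof.
split=> [A [[A0 _ _] _]|f g fS gS A AP|r f Sr fS A AP] //.
- by have [[_ AD _] _] := AP; apply: AD; [apply: fS|apply: gS].
by have [[_ _ AM] _] := AP; apply: AM => //; apply: fS.
Qed.

Lemma mod_iso_refl (M : set K) : mod_iso S M M.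
Proof. by exists id; split=> //; split=> // f Mf; exists f. Qed.

Lemma mod_iso_sym (M N : set K) :
  submodule S M -> mod_iso S M N -> mod_iso S N M.
Proof.
move=> [M0 MD MZ] [phi [[phiN phi_inj phi_surj] phiD phiZ]].
(* The inverse takes the default value 0 outside [N]. Its additivity and linearity use that [M] is
   closed under the operations, since [phi] is injective on [M] only. *)
pose psi g := xget 0 [set f | M f /\ phi f = g].
have psiP g : N g -> M (psi g) /\ phi (psi g) = g.
  move=> /phi_surj[f Mf fg].
  by apply: (@xgetPex _ 0 [set f | M f /\ phi f = g]); exists f.
have psi_uniq f g : N g -> M f -> phi f = g -> psi g = f.
  move=> Ng Mf fg; have [Mg phig] := psiP g Ng.
  by apply: phi_inj; rewrite ?inE // phig.
exists psi; split.
- split=> [g /psiP[]//|g h|f Mf].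
    rewrite !inE => /psiP[_ gE] /psiP[_ hE] gh.
    by rewrite -gE -hE gh.
  by exists (phi f); [exact: phiN|apply: psi_uniq => //; exact: phiN].
- move=> g h Ng Nh; have [Mg gE] := psiP g Ng; have [Mh hE] := psiP h Nh.
  have gh : phi (psi g + psi h) = g + h by rewrite phiD // gE hE.
  apply: psi_uniq => //; last exact: MD.
  by rewrite -gh; apply/phiN/MD.
move=> r g Sr Ng; have [Mg gE] := psiP g Ng.
have rg : phi (r * psi g) = r * g by rewrite phiZ // gE.
apply: psi_uniq => //; last exact: MZ.
by rewrite -rg; apply/phiN/MZ.
Qed.

Lemma mod_iso_trans (L M N : set K) :
  mod_iso S L M -> mod_iso S M N -> mod_iso S L N.
Proof.
move=> [phi [[phiM phi_inj phi_surj] phiD phiZ]].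
move=> [psi [[psiN psi_inj psi_surj] psiD psiZ]].
exists (psi \o phi); split.
- split=> [f Lf|f g fL gL|h Nh].
  + by apply/psiN/phiM.
  + move: (fL) (gL); rewrite !inE => Lf Lg /psi_inj e; apply: phi_inj => //.
    by apply: e; rewrite inE; apply: phiM.
  have [g Mg <-] := psi_surj h Nh; have [f Lf <-] := phi_surj g Mg.
  by exists f.
- by move=> f g Lf Lg /=; rewrite phiD // psiD //; apply: phiM.
by move=> r f Sr Lf /=; rewrite phiZ // psiZ //; apply: phiM.
Qed.

End SmallestSubmodule.

Section Quotients.
Variables (K : fieldType) (S : set K).
Hypothesis SD : forall f g, S f -> S g -> S (f + g).
Hypothesis SM : forall f g, S f -> S g -> S (f * g).
Implicit Types f g : K.

Definition quotient_of f := exists r s, [/\ S r, S s, r != 0 & r * f = s].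

Lemma quotient_sub f : S 1 -> S f -> quotient_of f.
Proof. by move=> S1 Sf; exists 1, f; rewrite mul1r oner_eq0. Qed.

Lemma quotientD f g : quotient_of f -> quotient_of g -> quotient_of (f + g).
Proof.
move=> [r [s [hr hs r0 rf]]] [r' [s' [hr' hs' r0' rf']]].
exists (r * r'), (r' * s + r * s'); split.
- exact: SM.
- by apply: SD; apply: SM.
- by rewrite mulf_neq0.
by rewrite -rf -rf'; ring.
Qed.

Lemma quotientM f g : quotient_of f -> quotient_of g -> quotient_of (f * g).
Proof.
move=> [r [s [hr hs r0 rf]]] [r' [s' [hr' hs' r0' rf']]].
exists (r * r'), (s * s'); split.
- exact: SM.
- exact: SM.
- by rewrite mulf_neq0.
by rewrite -rf -rf' mulrACA.
Qed.

Lemma quotientV f : quotient_of f -> quotient_of f^-1.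
Proof.
have [-> //|f0] := eqVneq f 0; first by rewrite invr0.
move=> [r [s [hr hs r0 rf]]]; exists s, r; split=> //.
  by rewrite -rf mulf_neq0.
by rewrite -rf mulfK.
Qed.

(** For [m] in [M] there are [r != 0] and [s] in [S] with [r * m = s * m0]. Applying [phi] shows
    that it multiplies by [phi m0 / m0]. *)
Lemma mod_iso_scaling (M N : set K) m0 : (forall f, quotient_of f) ->
  submodule S M -> M m0 -> m0 != 0 -> mod_iso S M N ->
  exists c, [/\ c != 0, forall m, M m -> N (c * m)
    & forall f, N f -> M (c^-1 * f)].
Proof.
move=> quot [M0 _ _] Mm0 m00 [phi [[phiN phi_inj phi_surj] phiD phiZ]].
pose c := phi m0 / m0.
have phiE m : M m -> phi m = c * m.
  move=> Mm; have [r [s [Sr Ss r0 rs]]] := quot (m / m0).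
  apply: (mulfI r0); rewrite -phiZ // (_ : r * m = s * m0) ?phiZ // -rs.
    by rewrite /c; field.
  by field.
have c0 : c != 0.
  apply/eqP => c0; case/eqP: m00; apply: phi_inj; rewrite ?inE //.
  by rewrite !phiE // c0 !mul0r.
exists c; split=> // [m Mm|f Nf]; first by rewrite -phiE //; apply: phiN.
by have [m Mm <-] := phi_surj f Nf; rewrite phiE // mulKf.
Qed.

End Quotients.

(** * The Hibi ring and its divisorial ideals *)

Section HibiModules.
Variables (R : realType) (k : fieldType) (disp : Order.disp_t).
Variable P : finPOrderType disp.
Local Notation K := (ratfun k P).
Local Notation hibi := (@hibi k disp P).
Local Notation divT a := (@divT k disp P R (fun e => (a e)%:~R)).
Implicit Types (f g : K) (x y : low P -> int) (a b : edge P -> int).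

(** Membership is tested term by term here, unlike in the generated module [divT a], which
    [divT_lset] encloses in it. *)
Definition lset a : set K := [set f | laurent f /\
  forall x, has_term f x -> forall e, a e <= sigma x e].

Lemma lsetD a f g : lset a f -> lset a g -> lset a (f + g).
Proof.
move=> [lf fa] [lg ga]; split; first exact: laurentD.
by move=> x /has_termD[//|//|/fa|/ga].
Qed.

Lemma lsetM a b f g :
  lset a f -> lset b g -> lset (fun e => a e + b e) (f * g).
Proof.
move=> [lf fa] [lg gb]; split; first exact: laurentM.
move=> z /has_termM[//|//|x [y [fx gy /funext ->]]] e.
by rewrite sigmaD lerD ?fa ?gb.
Qed.

Lemma lset_monomial a x : (forall e, a e <= sigma x e) -> lset a (monomial k x).
Proof.
move=> ax; split; first exact: laurent_monomial.
by move=> y /has_term_monomial/funext <-.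
Qed.

Lemma lset_const c : lset (fun _ => 0) (const P c).
Proof.
have cE := @laurent_tofrac k disp P c%:MP.
split; first by exists 0, c%:MP.
move=> x /(has_term_exponent cE)[m]; rewrite mcoeffC.
case: (m =P 0%MM) => [-> _ x0|_]; last by rewrite mulr0 eqxx.
move=> e; suff -> : x = (fun=> 0) by rewrite /sigma; case: etail; case: ehead.
by apply/funext => i; have := x0 i; rewrite mnm0E addr0.
Qed.

Lemma var_monomial (i : low P) :
  var k i = monomial k (fun j => (j == i : nat)%:Z).
Proof.
rewrite /monomial (bigD1 i) //= eqxx -exprnP expr1 big1 ?mulr1 // => j.
by move=> /negPf ->; rewrite expr0z.
Qed.

Lemma hibi_gen_monomial (I : {set P}) : hibi_gen k I =
  monomial k (fun j => if j is Some p then (p \in I : nat)%:Z else 1).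
Proof.
have prodE (s : seq P) : uniq s -> \prod_(p <- s) var k (Some p) =
    monomial k (fun j => if j is Some p then (p \in s : nat)%:Z else 0).
  elim: s => [|p s IH] => [_|/= /andP[ps /IH {}IH]].
    by rewrite big_nil -monomial0; congr monomial; apply/funext => -[].
  rewrite big_cons IH var_monomial -monomialD; congr monomial.
  apply/funext => -[q|]; last by rewrite addr0.
  rewrite inE (inj_eq Some_inj).
  case: eqVneq => [->|_] /=; last by rewrite add0r.
  by rewrite (negPf ps).
rewrite /hibi_gen -big_enum prodE ?enum_uniq // var_monomial -monomialD.
congr monomial; apply/funext => -[p|]; last by rewrite add0r.
by rewrite addr0 mem_enum.
Qed.

(** The exponent of a generator is the indicator of a poset ideal, extended by 1 at the minimum and
    0 at the maximum; it never increases along an edge. *)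
Lemma hibi_lset : hibi `<=` lset (fun _ => 0).
Proof.
apply: smallest_sub => [|_ [I idealI <-]].
  split=> [_ [c _ <-]|f g|f g f0 g0]; first exact: lset_const.
    exact: lsetD.
  have -> : (fun _ : edge P => 0 : int) = fun _ => 0 + 0.
    by apply/funext => e; rewrite addr0.
  exact: lsetM.
rewrite hibi_gen_monomial; apply: lset_monomial => e.
have := edge_lt e; rewrite /sigma.
case: etail => [[p|]|] //; case: ehead => [[q|]|] //=.
- move=> pq; rewrite subr_ge0; have [qI|//] := boolP (q \in I).
  by rewrite (idealI p q qI (ltW pq)).
- by move=> _; rewrite subr_ge0; case: (q \in I).
Qed.

Lemma subalgebra_hibi : subalgebra (range (@const k _ P)) hibi.
Proof. exact: subalgebra_smallest. Qed.

Lemma hibi_const c : hibi (const P c).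
Proof. by have [sub _ _] := subalgebra_hibi; apply: sub; exists c. Qed.

Lemma hibi0 : hibi 0.
Proof.
by rewrite -[0](_ : const P 0 = 0) ?/const ?tofrac0 //; exact: hibi_const.
Qed.

Lemma hibi1 : hibi 1.
Proof.
by rewrite -[1](_ : const P 1 = 1) ?/const ?tofrac1 //; exact: hibi_const.
Qed.

Lemma hibiD f g : hibi f -> hibi g -> hibi (f + g).
Proof. by have [_ D _] := subalgebra_hibi; apply: D. Qed.

Lemma hibiM f g : hibi f -> hibi g -> hibi (f * g).
Proof. by have [_ _ M] := subalgebra_hibi; apply: M. Qed.

Local Notation hibi_frac := (quotient_of hibi).

Lemma hibi_fracD f g : hibi_frac f -> hibi_frac g -> hibi_frac (f + g).
Proof. exact: (quotientD hibiD hibiM). Qed.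

Lemma hibi_fracM f g : hibi_frac f -> hibi_frac g -> hibi_frac (f * g).
Proof. exact: (quotientM hibiM). Qed.

Lemma hibi_fracV f : hibi_frac f -> hibi_frac f^-1.
Proof. exact: quotientV. Qed.

Lemma hibi_frac_hibi f : hibi f -> hibi_frac f.
Proof. exact: (quotient_sub hibi1). Qed.

Lemma hibi_frac_gen (I : {set P}) : poset_ideal I -> hibi_frac (hibi_gen k I).
Proof.
by move=> idealI; apply: hibi_frac_hibi; apply: sub_gen_smallest; exists I.
Qed.

(** The ideals of the elements [<= p] and [< p] differ by [p] alone, and the empty ideal gives the
    variable of the minimum. *)
Lemma hibi_frac_var (i : low P) : hibi_frac (var k i).
Proof.
case: i => [p|].
  pose I := finset (fun q : P => (q < p)%O).
  pose J := finset (fun q : P => (q <= p)%O).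
  have -> : var k (Some p) = hibi_gen k J / hibi_gen k I.
    apply: (mulIf (_ : hibi_gen k I != 0)).
      by rewrite hibi_gen_monomial monomial_neq0.
    rewrite mulfVK; last by rewrite hibi_gen_monomial monomial_neq0.
    rewrite /hibi_gen mulrA; congr (_ * _).
    rewrite [RHS](bigD1 p) ?inE //=; congr (_ * _).
    by apply: eq_bigl => q; rewrite !inE lt_neqAle andbC.
  apply: hibi_fracM; last apply: hibi_fracV;
    apply: hibi_frac_gen => q r; rewrite !inE.
    by move=> rp qr; apply: le_trans rp.
  by move=> rp qr; apply: le_lt_trans rp.
have -> : var k None = hibi_gen k (finset.set0 : {set P}).
  by rewrite /hibi_gen big_set0 mul1r.
by apply: hibi_frac_gen => p q; rewrite inE.
Qed.

(** Constants and variables are quotients of elements of [hibi], and such quotients are closed under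
    the field operations. This makes [mod_iso_scaling] applicable. *)
Lemma hibi_fracT f : hibi_frac f.
Proof.
suff hp p : hibi_frac (tofrac p).
  have [p [q [_ ->]]] := fractionP f.
  by apply: hibi_fracM; last apply: hibi_fracV.
elim/mpolyind: p => [|c m p _ _ IH].
  by rewrite tofrac0; exact: (hibi_frac_hibi hibi0).
rewrite tofracD -mul_mpolyC tofracM; apply: hibi_fracD => //.
apply: hibi_fracM; first exact: (hibi_frac_hibi (hibi_const _)).
rewrite mpolyXE_id rmorph_prod; elim/big_rec: _ => [|i g _ hg].
  exact: (hibi_frac_hibi hibi1).
apply: hibi_fracM => //; rewrite rmorphXn; elim: (m i) => [|j IHj].
  by rewrite expr0; exact: (hibi_frac_hibi hibi1).
rewrite exprS; apply: hibi_fracM => //.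
by have := hibi_frac_var (enum_val i); rewrite /var enum_valK.
Qed.

Lemma submodule_divT (a : edge P -> R) :
  submodule hibi (@Defs.divT k disp P R a).
Proof. exact: submodule_smallest. Qed.

Lemma divT_monomial a x : (forall e, a e <= sigma x e) -> divT a (monomial k x).
Proof.
by move=> ax; apply: sub_gen_smallest; exists x => // e; rewrite ler_int.
Qed.

Lemma divT_lset a : divT a `<=` lset a.
Proof.
apply: smallest_sub => [|_ [x ax <-]]; last first.
  by apply: lset_monomial => e; have := ax e; rewrite ler_int.
split=> [|f g|r f /hibi_lset r0 fa].
- by split; [exact: laurent0|move=> x /has_term0].
- exact: lsetD.
have -> : a = (fun e => 0 + a e) by apply/funext => e; rewrite add0r.
exact: lsetM.
Qed.

Lemma divT_translate a y f :
  divT a f -> divT (fun e => a e + sigma y e) (monomial k y * f).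
Proof.
(* The elements that the translation sends to the right place form a submodule, so checking the
   generators suffices. *)
pose M := [set f | divT (fun e => a e + sigma y e) (monomial k y * f)].
apply: (smallest_sub (X := M)) => [|_ [x ax <-]]; last first.
  rewrite /M /= -monomialD; apply: divT_monomial => e.
  by rewrite sigmaD addrC lerD2l -(ler_int R).
have [d0 dD dZ] := submodule_divT (fun e => (a e + sigma y e)%:~R).
split=> [|g h Mg Mh|r g Sr Mg]; rewrite /M /=.
- by rewrite mulr0.
- by rewrite mulrDr; apply: dD.
by rewrite mulrCA; apply: dZ.
Qed.

Lemma mod_iso_translate a b y : (forall e, b e = a e + sigma y e) ->
  mod_iso hibi (divT a) (divT b).
Proof.
move=> /funext ->; exists ( *%R (monomial k y)); split.
- split=> [f|f g _ _|g bg]; first exact: divT_translate.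
    exact/mulfI/monomial_neq0.
  exists ((monomial k y)^-1 * g); last by rewrite mulVKf ?monomial_neq0.
  rewrite -monomialN; have := @divT_translate _ (fun i => - y i) _ bg.
  by under [X in Defs.divT X]funext => e do rewrite sigmaN addrK.
- by move=> f g _ _; rewrite mulrDr.
by move=> r f _ _; rewrite mulrCA.
Qed.

Lemma divT_inhabited a : exists x, forall e, a e <= sigma x e.
Proof.
have [[e _]|ne] := pselect (exists e : edge P, True).
  by have [x _ ax] := sigma_tight a e; exists x.
by exists (fun=> 0) => e; case: ne; exists e.
Qed.

(* An isomorphism between these submodules of [K] is the multiplication by some
   [f]; both [f] and [1 / f] are Laurent polynomials, so that, looking at the
   constant term of their product, [f] has a term [y] and [1 / f] a term [- y].
   No cancellation occurs when a monomial is multiplied by [f], hence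
   translation by [y] matches the exponents of the two modules. *)
Lemma mod_iso_divT a b : mod_iso hibi (divT a) (divT b) ->
  exists y, forall e, b e = a e + sigma y e.
Proof.
have [x0 ax0] := divT_inhabited a; have [x1 bx1] := divT_inhabited b.
case/(mod_iso_scaling hibi_fracT (submodule_divT _) (divT_monomial ax0)).
  exact: monomial_neq0.
move=> f [f0 fb fVa].
have lf : laurent f.
  have -> : f = (f * monomial k x0) * (monomial k x0)^-1.
    by rewrite (mulfK (monomial_neq0 k x0)).
  rewrite -monomialN; apply: laurentM; last exact: laurent_monomial.
  by have [] := divT_lset (fb _ (divT_monomial ax0)).
have lfV : laurent f^-1.
  have -> : f^-1 = (f^-1 * monomial k x1) * (monomial k x1)^-1.
    by rewrite (mulfK (monomial_neq0 k x1)).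
  rewrite -monomialN; apply: laurentM; last exact: laurent_monomial.
  by have [] := divT_lset (fVa _ (divT_monomial bx1)).
have : has_term (f * f^-1) (fun=> 0).
  by rewrite mulfV // -monomial0; apply/has_term_monomial.
case/(has_termM lf lfV) => y [y' [fy fVy' yy']].
have y'E : y' = fun i => - y i.
  by apply/funext => i; apply/eqP; rewrite -addr_eq0 addrC -yy'.
rewrite {}y'E in fVy'.
have bE x : (forall e, a e <= sigma x e) ->
    forall e, b e <= sigma x e + sigma y e.
  move=> ax; have := fb _ (divT_monomial ax); rewrite mulrC.
  move=> /divT_lset[_ fx] e; rewrite -sigmaD; apply: fx.
  exact: has_term_translate.
have aE x : (forall e, b e <= sigma x e) ->
    forall e, a e <= sigma x e - sigma y e.
  move=> bx; have := fVa _ (divT_monomial bx); rewrite mulrC.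
  move=> /divT_lset[_ fx] e; rewrite -sigmaN -sigmaD; apply: fx.
  exact: has_term_translate.
(* Each inequality comes from an exponent at which the constraint of [e] is tight, for [a] and for
   [b] respectively. *)
exists y => e; apply/eqP; rewrite eq_le; apply/andP; split.
  by have [x xe /bE/(_ e)] := sigma_tight a e; rewrite xe.
have [x xe /aE/(_ e)] := sigma_tight b e; rewrite xe.
by clear; lia.
Qed.

End HibiModules.

(** * Integral points of the region and real potentials *)

Section ConicRegion.
Variables (R : realType) (disp : Order.disp_t) (P : finPOrderType disp).
Implicit Types (c : seq (hat P)) (e : edge P).

(** The differences of a potential telescope to 0 around a cycle. *)
Lemma cycle_sigma (F : zmodType) (x : low P -> F) c :
  is_cycle [set: edge P]%SET c ->
  \sum_(e in suppp c) sigma x e = \sum_(e in suppm c) sigma x e.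
Proof.
case/andP=> /andP[cyc Uc] sz; apply/eqP; rewrite -subr_eq0; apply/eqP.
rewrite -sumrN -(cycle_weight_edges _ (fun e => - sigma x e)) //.
rewrite -(cycle_weight_potential (Defs.coord x) c).
case: c cyc {Uc sz} => // u p cyc; apply: eq_path_weight cyc => v w.
move=> /adjP[e _ /joinsP[] ee].
  have [-> ->] : v = etail e /\ w = ehead e by rewrite /etail /ehead ee.
  by rewrite edge_weight_fw.
have [-> ->] : w = etail e /\ v = ehead e by rewrite /etail /ehead ee.
by rewrite edge_weight_bw opprB.
Qed.

(** By [cycle_sigma] both supports have the same sum of [sigma x]. Over either one, the sum of [a]
    is at least this value and exceeds it by less than the size of the support, which is nonempty.
    Integrality turns the strict bounds into the shifts by 1. *)
Lemma ceil_cycle_bounds (x : low P -> R) (a : edge P -> int) c :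
  (forall e, sigma x e <= (a e)%:~R < sigma x e + 1) ->
  is_cycle [set: edge P]%SET c ->
  - #|suppm c|%:R + 1 <= \sum_e (signed_vec c e)%:~R * ((a e)%:~R : R)
    <= #|suppp c|%:R - 1.
Proof.
move=> ax cyc; have /andP[/andP[_ Uc] sz] := cyc.
have lo (A : {set edge P}) : \sum_(e in A) sigma x e <= (\sum_(e in A) a e)%:~R.
  by rewrite raddf_sum; apply: ler_sum => e _; have /andP[] := ax e.
have hi (A : {set edge P}) : (0 < #|A|)%N ->
    (\sum_(e in A) a e)%:~R < \sum_(e in A) sigma x e + #|A|%:R.
  case/card_gt0P=> e0 eA; rewrite -sumr_const -big_split raddf_sum.
  rewrite (bigD1 e0) //= [ltRHS](bigD1 e0) //=.
  have /andP[_ lt0] := ax e0; apply: ltr_leD => //.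
  by apply: ler_sum => e _; have /andP[_ /ltW] := ax e.
have sE := cycle_sigma x cyc.
have lop := lo (suppp c); have lom := lo (suppm c).
have hip := hi _ (suppp_gt0 cyc); have him := hi _ (suppm_gt0 cyc).
rewrite sum_signed_vec // -!raddf_sum /=.
move: sE lop lom hip him; move: (\sum_(e in suppp c) sigma x e) => s <-.
move: (\sum_(e in suppp c) a e) (\sum_(e in suppm c) a e) => n1 n2.
move: #|suppp c| #|suppm c|; clear => mp mm s1 s2 h1 h2.
have k1 : n2 < n1 + mm%:Z.
  by rewrite -(ltr_int R) intrD; apply: lt_le_trans h2 _; rewrite lerD2r.
have k2 : n1 < n2 + mp%:Z.
  by rewrite -(ltr_int R) intrD; apply: lt_le_trans h1 _; rewrite lerD2r.
rewrite -[mm%:R]/(mm%:Z%:~R) -[mp%:R]/(mp%:Z%:~R) -(intrN R mm) -intrB.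
rewrite -(intrD R _ 1) -(intrB R _ 1) !ler_int.
by move: k1 k2; clear; lia.
Qed.

Variables (m : nat) (e2 : 'I_m -> edge P).

Definition int_vec (z : 'rV[int]_m) e : int := \sum_(i | e2 i == e) z 0 i.

Lemma edge_vecE z : edge_vec R e2 z = fun e => (int_vec z e)%:~R.
Proof. by apply/funext => e; rewrite /edge_vec /int_vec raddf_sum. Qed.

Lemma int_vec_out z e : e \notin codom e2 -> int_vec z e = 0.
Proof.
move=> ne; apply: big_pred0 => i; apply/negP => /eqP ee.
by case/negP: ne; rewrite -ee codom_f.
Qed.

Lemma int_vec_inj z i : injective e2 -> int_vec z (e2 i) = z 0 i.
Proof. by move=> inj; apply: big_pred1 => j; rewrite (inj_eq inj). Qed.

Lemma sum_int_vec (h : edge P -> R) z :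
  \sum_i h (e2 i) * (map_mx (fun x : int => x%:~R : R) z) 0 i =
  \sum_e h e * (int_vec z e)%:~R.
Proof.
rewrite (partition_big e2 xpredT) //=; apply: eq_bigr => e _.
rewrite /int_vec raddf_sum mulr_sumr; apply: eq_bigr => i /eqP <-.
by rewrite mxE.
Qed.

(** The lower bound for a circuit says that its weight is at least 1 when an edge weighs [a] upwards
    and [1 - a] downwards, for [a] the vector [int_vec z]. *)
Lemma conic_region_potential (z : 'rV[int]_m) :
  conic_region e2 (map_mx (fun x : int => x%:~R : R) z) ->
  exists x : low P -> R, forall e, Num.ceil (sigma x e) = int_vec z e.
Proof.
move=> zc; have [|x xP] := @ceil_potential _ P R (fun e => (int_vec z e)%:~R).
  apply: cycle_weight_circuits => c circ.
  have [/andP[/andP[_ Uc] sz] _] := circ.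
  have := zc c circ; rewrite (sum_int_vec (fun e => (signed_vec c e)%:~R)).
  rewrite sum_signed_vec // cycle_weight_edges // sumrB sumr_const.
  move: (\sum_(e in _) _) (\sum_(e in _) _) (#|suppm c|%:R) => s1 s2 s3.
  by case/andP => + _; clear; lra.
by exists x => e; apply: ceil_def; rewrite intrB; exact: xP.
Qed.

Lemma ceil_conic_region (x : low P -> R) (z : 'rV[int]_m) :
  (forall e, sigma x e <= (int_vec z e)%:~R < sigma x e + 1) ->
  conic_region e2 (map_mx (fun x : int => x%:~R : R) z).
Proof.
move=> xz c [cyc _]; rewrite (sum_int_vec (fun e => (signed_vec c e)%:~R)).
exact: ceil_cycle_bounds cyc.
Qed.

End ConicRegion.

(** * Isomorphism classes and the bijection *)

Lemma iso_class_eq (R : realType) (k : fieldType) (disp : Order.disp_t)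
    (P : finPOrderType disp) (M N : set (ratfun k P)) :
  submodule (@hibi k _ P) M -> mod_iso (@hibi k _ P) M N ->
  iso_class R M = iso_class R N.
Proof.
move=> subM MN; apply/seteqP; split=> L [divL isoL]; split=> //.
  exact: mod_iso_trans (mod_iso_sym subM MN) isoL.
exact: mod_iso_trans MN isoL.
Qed.

Theorem theorem1p2 (R : realType) (k : closedFieldType)
    (hk : [pchar k] =i pred0)
    (disp : Order.disp_t) (P : finPOrderType disp) (d n : nat)
    (hd : #|{: hat P}| = d.+1) (hn : #|{: edge P}| = n)
    (T : {set edge P}) (hT : spanning_tree T)
    (e1 : 'I_d -> edge P) (e1_inj : injective e1)
    (e1_T : forall e : edge P, (e \in T) = (e \in codom e1))
    (e2 : 'I_(n - d) -> edge P) (e2_inj : injective e2)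
    (e2_T : forall e : edge P, (e \notin T) = (e \in codom e2)) :
  set_bij
    [set z : 'rV[int]_(n - d) |
      conic_region e2 (map_mx (fun x : int => x%:~R : R) z)]
    (@conic_classes k disp P R)
    (fun z : 'rV[int]_(n - d) =>
       iso_class R (divT (k := k) (edge_vec R e2 z))).
Proof.
have [conn forest] := hT.
have zT z e : e \in T -> int_vec e2 z e = 0.
  by move=> eT; apply: int_vec_out; rewrite -e2_T eT.
split=> [z /conic_region_potential[x xz]|z z' _ _|
    _ [M [[a0 _ <-] [x isoM]] <-]].
- exists (divT (k := k) (edge_vec R e2 z)) => //; split.
    by exists (edge_vec R e2 z).
  exists x; have -> : (fun e => (Num.ceil (sigma x e))%:~R) = edge_vec R e2 z.
    by rewrite edge_vecE; apply/funext => e; rewrite xz.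
  exact: mod_iso_refl.
(* A class contains its own module, so equal classes yield an isomorphism. *)
- move=> zz'; have : iso_class R (divT (k := k) (edge_vec R e2 z'))
      (divT (k := k) (edge_vec R e2 z')).
    by split; [exists (edge_vec R e2 z')|exact: mod_iso_refl].
  rewrite -zz' => -[_]; rewrite !edge_vecE => /mod_iso_divT[y yE].
  (* Both vectors vanish on the tree, hence so does [sigma y], and the tree is connected. *)
  have y0 : forall e, sigma y e = 0.
    apply: connected_potential0 conn _ => e eT.
    by have := yE e; rewrite !zT // add0r => <-.
  apply/rowP => i; rewrite -!(int_vec_inj _ _ e2_inj).
  by rewrite yE y0 addr0.
pose a e := Num.ceil (sigma x e).
(* Subtracting the integral potential that agrees with [a] on the tree normalises [a]. *)
have [y ya] := forest_potential a forest.
pose z : 'rV[int]_(n - d) := \row_i (a (e2 i) - sigma y (e2 i)).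
have za e : int_vec e2 z e = a e - sigma y e.
  have [eT|] := boolP (e \in T); first by rewrite zT // ya // subrr.
  by rewrite e2_T => /codomP[i ->]; rewrite int_vec_inj // mxE.
exists z => /=.
  (* Rounding up commutes with the integral shift by [sigma y]. *)
  apply: (@ceil_conic_region _ _ _ _ _ (fun i => x i + - (y i)%:~R)) => e.
  rewrite sigmaD sigmaN sigma_intr za; move: (sigma y e) => sy.
  have := ceil_itv (sigma x e); rewrite -/(a e) !intrB.
  by move: (_%:~R) (sigma x e) (sy%:~R); clear => u v w; lra.
apply/esym; apply: iso_class_eq; first exact: submodule_divT.
apply: mod_iso_trans isoM _; rewrite edge_vecE.
apply: (@mod_iso_translate _ _ _ _ a _ (fun i => - y i)) => e.
by rewrite za sigmaN.
Qed.
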